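(* For each $\varepsilon>0$, $\lim_{k\to\infty}\tau\big(k,\lceil(2+\varepsilon)k\rceil\big)=0$.
   Context: Let $\mathbf{1}$ be the all-ones vector in $\mathbb{R}^k$ and $\mathcal{Q}^*_k:=\{-1,+1\}^k\setminus\{-\mathbf{1},\mathbf{1}\}$. For $Y_{k,m}$ a uniformly random $m$-element subset of $\mathcal{Q}^*_k$, $\tau(k,m):=\Pr[\operatorname{conv}(Y_{k,m})\cap\operatorname{conv}\{-\mathbf{1},\mathbf{1}\}=\varnothing]$. *)

(* Defs.v *)
From HB Require Import structures.
From mathcomp Require Import all_boot all_order all_algebra.
From mathcomp Require Import all_classical all_reals all_analysis.

Set Implicit Arguments.
Unset Strict Implicit.
Unset Printing Implicit Defensive.

Import Order.TTheory GRing.Theory Num.Theory.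
Import numFieldNormedType.Exports.

Local Open Scope classical_set_scope.
Local Open Scope ring_scope.

Definition conv_hull (R : numDomainType) (V : lmodType R) (A : set V) : set V :=
  smallest (@convex_set R V) A.

Definition ones (R : realType) (k : nat) : 'rV[R]_k := const_mx 1.

(* The points of {-1,+1}^k are indexed by a finite type, so that random subsets
   of the cube are elements of a finite type; the two lemmas below state that
   the indexing is a bijection onto {-1,+1}^k. *)
Definition cube_pt (R : realType) (k : nat) (s : {ffun 'I_k -> bool}) : 'rV[R]_k :=
  \row_i (-1) ^+ s i.

Lemma cube_pt_inj (R : realType) (k : nat) : injective (@cube_pt R k).
Proof.
move=> s t /rowP st; apply/ffunP => i; move: (st i); rewrite !mxE.
exact: signr_inj.
Qed.

Lemma range_cube_pt (R : realType) (k : nat) :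
  range (@cube_pt R k) = [set v | forall i, v ord0 i = 1 \/ v ord0 i = -1].
Proof.
apply/seteqP; split => [_ [s _ <-] i | v hv] /=.
  by rewrite mxE; case: (s i); [right; rewrite expr1 | left; rewrite expr0].
exists [ffun i => v ord0 i == -1] => //; apply/rowP => i; rewrite mxE ffunE.
case: (hv i) => ->; last by rewrite eqxx expr1.
by rewrite eq_sym eqNr oner_eq0.
Qed.

Definition Qstar (R : realType) (k : nat) : {set {ffun 'I_k -> bool}} :=
  [set s | (cube_pt R s != - ones R k) && (cube_pt R s != ones R k)]%SET.

Definition msubsets (R : realType) (k m : nat) : {set {set {ffun 'I_k -> bool}}} :=
  [set Y : {set {ffun 'I_k -> bool}} | (Y \subset Qstar R k) && (#|Y| == m)]%SET.

Definition avoids_diagonal (R : realType) (k : nat)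
    (Y : {set {ffun 'I_k -> bool}}) : Prop :=
  conv_hull [set cube_pt R s | s in [set` Y]]
    `&` conv_hull [set - ones R k; ones R k] = set0.

(* Probability under the uniform distribution on msubsets R k m; by the
   convention x / 0 = 0 it is 0 when m exceeds the cardinal of Qstar R k. *)
Definition tau (R : realType) (k m : nat) : R :=
  #|[set Y in msubsets R k m | `[< avoids_diagonal R Y >]]%SET|%:R
    / #|msubsets R k m|%:R.

(* Main.v *)
(* The segment contains the origin, so tau k m is at most the probability that
   conv Y misses the origin. Such a Y contains no antipodal pair, hence is obtained
   from an m-subset B of a transversal of the antipodal map by choosing signs. A
   linear relation on k + 1 points of B becomes a positive one for a suitable choice
   of their signs, so the good sign choices shatter no (k+1)-set, and by
   Sauer-Shelah at most sum_(i <= k) C(m, i) of the 2^m choices are good. As in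
   Chebyshev's inequality, sum_i (m - 2i)^2 C(m, i) = m 2^m bounds the resulting
   probability by m / (m - 2k)^2, which is O(1/k) for m >= (2 + eps) k. *)
Require Import Defs.
From mathcomp Require Import all_boot all_order all_algebra.
From mathcomp Require Import all_classical all_reals all_analysis.
From mathcomp Require Import zify ring lra.
(* Imported again because classical_sets reuses the names of their lemmas. *)
Import fintype boot.finset.
Import Order.TTheory GRing.Theory Num.Theory.
Import numFieldNormedType.Exports.
Local Open Scope classical_set_scope.
Local Open Scope ring_scope.

Set Implicit Arguments.
Unset Strict Implicit.
Unset Printing Implicit Defensive.

(** * Shattering and the Sauer-Shelah bound *)

Definition shatters (T : finType) (F : {set {set T}}) (S : {set T}) : bool :=
  [forall X : {set T}, (X \subset S) ==> [exists A in F, (A :&: S)%SET == X]].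

Lemma shattersP (T : finType) (F : {set {set T}}) (S : {set T}) :
  reflect (forall X : {set T}, X \subset S ->
             exists2 A : {set T}, A \in F & (A :&: S)%SET = X)
          (shatters F S).
Proof.
apply: (iffP forallP) => shF X.
  by move/(implyP (shF X))/exists_inP => [A AF /eqP]; exists A.
by apply/implyP => /shF[A AF /eqP AS]; apply/exists_inP; exists A.
Qed.

(* Pajor's form of the Sauer-Shelah lemma. *)
Lemma leq_card_shattered (T : finType) (F : {set {set T}}) (B : {set T}) :
  F \subset powerset B ->
  (#|F| <= #|[set S in powerset B | shatters F S]%SET|)%N.
Proof.
have [n] := ubnP #|B|; elim: n B F => // n IHn B F.
case: (set_0Vmem B) => [-> _|[b bB]].
  rewrite powerset0 => /subsetP F0; apply/subset_leq_card/subsetP => A AF.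
  have /set1P A0 := F0 _ AF.
  rewrite !inE A0 eqxx /=; apply/shattersP => X; rewrite subset0 => /eqP->.
  by exists A; rewrite // setI0.
move=> ltBn /subsetP FB.
(* Induct by splitting [F] at [b]: [F0] and [F1] both live on [B] without [b], and removing [b] is
   injective on [Fin], so their cardinals add up to that of [F]. *)
pose Fin := [set A in F | b \in A]%SET.
pose F0 := [set A in F | b \notin A]%SET.
pose F1 := [set (A :\ b)%SET | A in Fin]%SET.
have {ltBn} ltBbn : (#|(B :\ b)%SET| < n)%N.
  by move: ltBn; rewrite (cardsD1 b B) bB; lia.
have F0B : F0 \subset powerset (B :\ b).
  apply/subsetP => A; rewrite !inE => /andP[/FB]; rewrite inE => AB nbA.
  by rewrite subsetD1 AB.
have F1B : F1 \subset powerset (B :\ b).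
  apply/subsetP => _ /imsetP[A + ->]; rewrite !inE => /andP[/FB]; rewrite inE => AB _.
  exact: setSD.
have cardF : #|F| = (#|F0| + #|F1|)%N.
  rewrite card_in_imset => [|A1 A2]; last first.
    by rewrite !inE => /andP[_ b1] /andP[_ b2] e12; rewrite -(setD1K b1) e12 setD1K.
  by rewrite -(cardsID [set A : {set T} | b \in A] F) addnC; congr addn;
    apply: eq_card => A; rewrite !inE // andbC.
set sh := fun G : {set {set T}} => [set S in powerset (B :\ b) | shatters G S]%SET.
rewrite cardF; apply: leq_trans (leq_add (IHn _ _ ltBbn F0B) (IHn _ _ ltBbn F1B)) _.
(* A set shattered by [F0] or [F1] is shattered by [F]; one shattered by both stays shattered after
   adding [b]. So the union counts shattered sets without [b], the intersection those with [b]. *)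
rewrite -/(sh F0) -/(sh F1) -cardsUI.
set P := [set S in powerset B | shatters F S]%SET.
have shF01 S : S \in (sh F0 :|: sh F1)%SET ->
    (S \subset (B :\ b)%SET) && shatters F S.
  rewrite !inE -andb_orr => /andP[SB /orP[]/shattersP sh01]; rewrite SB /=;
    apply/shattersP => X /sh01[A].
    by rewrite !inE => /andP[AF _] <-; exists A.
  case/imsetP=> A'; rewrite !inE => /andP[AF _] -> <-; exists A' => //.
  apply/setP => x; rewrite !inE; case: eqVneq => //= ->.
  by move: SB; rewrite subsetD1 => /andP[_ /negPf->]; rewrite andbF.
have shb S : S \in (sh F0 :&: sh F1)%SET -> shatters F (b |: S)%SET.
  rewrite !inE => /andP[/andP[SB /shattersP sh0] /andP[_ /shattersP sh1]].
  have nbS : b \notin S by move: SB; rewrite subsetD1 => /andP[].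
  apply/shattersP => X XS; have XSb : (X :\ b)%SET \subset S by rewrite subDset.
  have [bX|nbX] := boolP (b \in X).
    have [_ /imsetP[A + ->] AX] := sh1 _ XSb; rewrite !inE => /andP[AF bA].
    exists A => //; apply/setP => x; move/setP/(_ x): AX; rewrite !inE.
    by case: eqVneq => [->|]; rewrite ?bA ?bX.
  have [A + AX] := sh0 _ XSb; rewrite !inE => /andP[AF nbA].
  exists A => //; apply/setP => x; move/setP/(_ x): AX; rewrite !inE.
  by case: eqVneq => [->|]; rewrite ?(negPf nbA) ?(negPf nbX).
rewrite -(cardsID [set S : {set T} | b \in S] P) addnC.
apply: leq_add.
  have injb : {in (sh F0 :&: sh F1)%SET &, injective (fun S => b |: S)%SET}.
    move=> S1 S2; rewrite !inE !subsetD1 => /andP[/andP[/andP[_ n1] _] _].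
    by move=> /andP[/andP[/andP[_ n2] _] _] e12; rewrite -(setU1K n1) e12 setU1K.
  rewrite -(card_in_imset injb); apply/subset_leq_card/subsetP => _ /imsetP[S SP ->].
  rewrite !inE shb // eqxx !andbT subUset sub1set bB /=.
  by move: SP; rewrite !inE subsetD1 => /andP[/andP[/andP[]]].
apply/subset_leq_card/subsetP => S /shF01; rewrite !inE subsetD1.
by case/andP=> /andP[-> ->] ->.
Qed.

Lemma card_small_subsets (T : finType) (B : {set T}) (d : nat) :
  #|[set S in powerset B | (#|S| <= d)%N]%SET| = (\sum_(i < d.+1) 'C(#|B|, i))%N.
Proof.
rewrite -sum1_card (partition_big (fun S : {set T} => inord #|S| : 'I_d.+1) xpredT) //=.
apply: eq_bigr => i _; rewrite -cards_draws -sum1_card; apply: eq_bigl => S.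
rewrite !inE -andbA; congr andb; apply/andP/eqP => [[Sd /eqP<-]|Si].
  by rewrite inordK.
by rewrite Si -ltnS ltn_ord inord_val.
Qed.

Lemma sauer_shelah (T : finType) (F : {set {set T}}) (B : {set T}) (d : nat) :
  F \subset powerset B ->
  (forall S : {set T}, S \subset B -> shatters F S -> (#|S| <= d)%N) ->
  (#|F| <= \sum_(i < d.+1) 'C(#|B|, i))%N.
Proof.
move=> FB shd; rewrite -card_small_subsets; apply: leq_trans (leq_card_shattered FB) _.
apply/subset_leq_card/subsetP => S; rewrite !inE => /andP[SB shS].
by rewrite SB shd.
Qed.

(** * Binomial estimates *)

(** Among the m-subsets of n disjoint pairs, the left side counts those meeting each pair at most
    once. The proof compares falling factorials factor by factor. *)
Lemma exp2_bin_le (n m : nat) : (2 ^ m * 'C(n, m) <= 'C(n.*2, m))%N.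
Proof.
suff ffle : (2 ^ m * n ^_ m <= n.*2 ^_ m)%N.
  by rewrite -(leq_pmul2r (fact_gt0 m)) -mulnA !bin_ffact.
elim: m n => [|m IHm] [|n]; rewrite ?ffactn0 ?ffact0n ?muln0 //.
rewrite doubleS !ffactSS expnS; apply: (@leq_trans (n.*2.+2 * n.*2 ^_ m)%N).
  have -> : (2 * 2 ^ m * (n.+1 * n ^_ m) = n.*2.+2 * (2 ^ m * n ^_ m))%N.
    by rewrite -doubleS -muln2; ring.
  by rewrite leq_mul2l IHm.
rewrite leq_mul2l /=; case: m {IHm} => // m.
by rewrite ffactSS ffactnSr mulnC leq_mul //; lia.
Qed.

Lemma sum_binS (V : nmodType) (f : nat -> V) (m : nat) :
  \sum_(i < m.+2) f i *+ 'C(m.+1, i) =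
  \sum_(i < m.+1) (f i + f i.+1) *+ 'C(m, i).
Proof.
rewrite big_ord_recl /= bin0; under eq_bigr => i _ do rewrite binS mulrnDr.
rewrite big_split /= addrA; under [RHS]eq_bigr => i _ do rewrite mulrnDl.
rewrite [RHS]big_split /=; congr (_ + _).
by rewrite big_ord_recr /= bin_small // mulr0n addr0 [RHS]big_ord_recl /= bin0.
Qed.

(** The second moment of a sum of m independent random signs is m, here without dividing by 2 ^ m.
    With x = m - 2i, the inductive step is (x + 1)^2 + (x - 1)^2 = 2x^2 + 2. *)
Lemma sum_bin_sqr (R : comPzRingType) (m : nat) :
  \sum_(i < m.+1) (m%:R - i%:R *+ 2) ^+ 2 *+ 'C(m, i) = m%:R * 2 ^+ m :> R.
Proof.
elim: m => [|m IHm]; first by rewrite big_ord1 mul0rn subr0 mul0r expr2 mul0r mul0rn.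
rewrite (sum_binS (fun i => (m.+1%:R - i%:R *+ 2) ^+ 2)).
have -> : \sum_(i < m.+1) ((m.+1%:R - i%:R *+ 2) ^+ 2
             + (m.+1%:R - i.+1%:R *+ 2) ^+ 2) *+ 'C(m, i)
   = 2 * \sum_(i < m.+1) (m%:R - i%:R *+ 2) ^+ 2 *+ 'C(m, i)
     + 2 * \sum_(i < m.+1) 'C(m, i)%:R :> R.
  rewrite !big_distrr -big_split /=; apply: eq_bigr => i _.
  by rewrite -mulr_natr -[_ *+ 'C(_, _)]mulr_natr -(natr1 m) -(natr1 (val i)); ring.
have sumb : (\sum_(i < m.+1) 'C(m, i) = 2 ^ m)%N.
  by rewrite -[2%N]/(1 + 1)%N expnDn; apply: eq_bigr => i _; rewrite !exp1n !muln1.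
by rewrite IHm -natr_sum sumb natrX -(natr1 m) exprS; ring.
Qed.

(** Keep only the terms i <= k of the second moment: there m - 2i >= m - 2k >= 0, so squaring
    preserves the order. *)
Lemma sum_bin_tail_le (R : realFieldType) (m k : nat) : (k.*2 <= m)%N ->
  (\sum_(i < k.+1) 'C(m, i))%N%:R * (m%:R - k%:R *+ 2) ^+ 2 <= m%:R * 2 ^+ m :> R.
Proof.
move=> km; rewrite -sum_bin_sqr natr_sum big_distrl /=.
have lekm : (k.+1 <= m.+1)%N by lia.
rewrite (big_ord_widen m.+1 (fun i => 'C(m, i)%:R * (m%:R - k%:R *+ 2) ^+ 2 : R) lekm).
rewrite [leRHS](bigID (fun i : 'I_m.+1 => (i < k.+1)%N)) /=.
rewrite -[leLHS]addr0 lerD ?sumr_ge0 // => [|i _]; last by rewrite mulrn_wge0 ?sqr_ge0.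
apply: ler_sum => i ik; rewrite -[leRHS]mulr_natl ler_wpM2l //.
have km' : k%:R *+ 2 <= m%:R :> R by rewrite -mulr_natl -natrM ler_nat mul2n.
have ik' : i%:R <= k%:R :> R by rewrite ler_nat.
by rewrite lerXn2r ?nnegrE; lra.
Qed.

(** * Linear relations and convex combinations *)

Lemma linear_dependency (F : fieldType) (T : finType) (k : nat)
    (v : T -> 'rV[F]_k) (S : {set T}) : (k < #|S|)%N ->
  exists2 c : T -> F, \sum_(s in S) c s *: v s = 0
                    & exists2 s, s \in S & c s != 0.
Proof.
move=> kS; have /card_gt0P[s0 s0S] : (0 < #|S|)%N by apply: leq_trans kS.
pose M := \matrix_(i < #|S|) v (enum_val i).
have : kermx M != 0.
  by rewrite -mxrank_eq0 mxrank_ker subn_eq0 -ltnNge (leq_ltn_trans (rank_leq_col M)).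
(* Outside [S], [enum_rank_in] returns a default index; only the values of the coefficients on [S]
   matter. *)
case/rowV0Pn=> w /sub_kermxP wM w0; exists (fun s => w 0 (enum_rank_in s0S s)).
  rewrite big_enum_val -[RHS]wM mulmx_sum_row; apply: eq_bigr => i _ /=.
  by rewrite enum_valK_in rowK.
have /existsP[i wi] : [exists i, w 0 i != 0].
  apply: contraNT w0 => /existsPn w0; apply/eqP/rowP => i.
  by rewrite mxE; apply/eqP/negPn.
by exists (enum_val i); rewrite ?enum_valP ?enum_valK_in.
Qed.

(** Passes from two-point convexity to finite weighted averages. Dividing by the total weight spares
    the callers a normalisation. *)
Lemma convex_set_sum (R : realFieldType) (V : lmodType R) (A : set V)
    (I : eqType) (r : seq I) (c : I -> R) (v : I -> V) :
  convex_set A -> {in r, forall i, 0 <= c i} -> {in r, forall i, A (v i)} ->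
  0 < \sum_(i <- r) c i ->
  A ((\sum_(i <- r) c i)^-1 *: \sum_(i <- r) c i *: v i).
Proof.
move=> cA; elim: r => [|i r IHr] c0 Av; first by rewrite big_nil ltxx.
have cr0 : {in r, forall j, 0 <= c j} by move=> j jr; rewrite c0 // inE jr orbT.
have Avr : {in r, forall j, A (v j)} by move=> j jr; apply: Av; rewrite inE jr orbT.
have ci0 : 0 <= c i by rewrite c0 ?mem_head.
have Avi : A (v i) by apply: Av; rewrite mem_head.
have: 0 <= \sum_(j <- r) c j by rewrite big_seq sumr_ge0.
(* If the remaining weights sum to 0, they all vanish and the average is [v i]; otherwise average
   [v i] with the point given by induction. *)
rewrite !big_cons le_eqVlt => /predU1P[/esym s0|s_gt0 cs_gt0].
  rewrite s0 addr0 => ci_gt0.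
  suff -> : \sum_(j <- r) c j *: v j = 0.
    by rewrite addr0 scalerA mulVf ?scale1r // gt_eqF.
  move/eqP: s0; rewrite big_seq psumr_eq0 // => /allP s0.
  rewrite big_seq big1 // => j jr.
  by have /implyP/(_ jr)/eqP-> := s0 j jr; rewrite scale0r.
set s := \sum_(j <- r) c j in s_gt0 cs_gt0 *; set x := \sum_(j <- r) _.
have t0 : 0 <= c i / (c i + s) by rewrite divr_ge0 // ltW.
have t1 : c i / (c i + s) <= 1 by rewrite ler_pdivrMr // mul1r lerDl ltW.
have := cA _ _ (Itv01 t0 t1) (mem_set Avi) (mem_set (IHr cr0 Avr s_gt0)).
move/set_mem.
congr A; rewrite /conv /= scalerDr !scalerA; congr (_ *: _ + _ *: _).
  by rewrite mulrC.
transitivity ((1 - c i / (c i + s)) * s^-1); first by [].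
by field; rewrite !gt_eqF.
Qed.

(** A relation of positive total weight, once normalised, puts the origin in the hull of [Y]; the
    origin is also the midpoint of the diagonal. *)
Lemma avoids_diagonal_no_relation (R : realType) (k : nat)
    (Y : {set {ffun 'I_k -> bool}}) (I : finType) (P : {set I})
    (c : I -> R) (f : I -> {ffun 'I_k -> bool}) :
  avoids_diagonal R Y -> {in P, forall i, f i \in Y} ->
  {in P, forall i, 0 <= c i} -> \sum_(i in P) c i *: cube_pt R (f i) = 0 ->
  {in P, forall i, c i = 0}.
Proof.
move=> avY fY c0 rel.
apply: (psumr_eq0P c0); apply/eqP; rewrite eq_le sumr_ge0 ?andbT // leNgt.
apply/negP => sc_gt0; suff : classical_sets.set0 (0 : 'rV[R]_k) by [].
rewrite -avY; split.
  move=> A [cA YA].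
  have := @convex_set_sum R _ A I (enum P) c (fun i => cube_pt R (f i)) cA.
  rewrite !big_enum /= rel scaler0; apply=> // i; rewrite mem_enum => iP; first exact: c0.
  by apply: YA; exists (f i) => //; exact: fY.
move=> A [cA oA].
have := @convex_set_sum R _ A bool [:: true; false] (fun=> 1)
  (fun b : bool => if b then ones R k else - ones R k) cA.
rewrite !big_cons !big_nil addr0 addr0 !scale1r subrr scaler0; apply=> //.
by move=> [] _; apply: oA; [right|left].
Qed.

(** * Antipodes and choices of signs *)

Definition antipode (k : nat) (s : {ffun 'I_k -> bool}) : {ffun 'I_k -> bool} :=
  [ffun i => ~~ s i].

Lemma antipodeK (k : nat) : involutive (@antipode k).
Proof. by move=> s; apply/ffunP => i; rewrite !ffunE negbK. Qed.

Lemma cube_pt_antipode (R : realType) (k : nat) (s : {ffun 'I_k -> bool}) :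
  cube_pt R (antipode s) = - cube_pt R s.
Proof. by apply/rowP => i; rewrite !mxE ffunE signrN. Qed.

Lemma antipode_Qstar (R : realType) (k : nat) (s : {ffun 'I_k -> bool}) :
  (antipode s \in Qstar R k) = (s \in Qstar R k).
Proof. by rewrite !inE cube_pt_antipode eqr_opp eqr_oppLR andbC. Qed.

Lemma avoids_diagonal_antipode (R : realType) (k : nat)
    (Y : {set {ffun 'I_k -> bool}}) (s : {ffun 'I_k -> bool}) :
  avoids_diagonal R Y -> s \in Y -> antipode s \notin Y.
Proof.
move=> avY sY; apply/negP => asY.
have one0 := @avoids_diagonal_no_relation R k Y bool [set: bool] (fun=> 1)
  (fun b => if b then s else antipode s) avY.
suff /eqP : (1 : R) = 0 by rewrite oner_eq0.
apply: (one0 _ _ _ true); rewrite ?inE //; first by case.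
under eq_bigl do rewrite inE.
by rewrite big_bool /= !scale1r cube_pt_antipode subrr.
Qed.

(** A choice of signs on [B] is encoded by the set [A] of points left unchanged, so that the good
    choices form a set family to which shattering applies. *)
Definition reorient (k : nat) (B A : {set {ffun 'I_k -> bool}}) :=
  (A :|: [set antipode s | s in B :\: A])%SET.

Lemma card_reorient_avoids (R : realType) (k : nat)
    (B : {set {ffun 'I_k -> bool}}) :
  (#|[set A in powerset B | `[< avoids_diagonal R (reorient B A) >]]%SET|
     <= \sum_(i < k.+1) 'C(#|B|, i))%N.
Proof.
apply: sauer_shelah => [|S SB /shattersP shS].
  by apply/subsetP => A; rewrite !inE => /andP[].
rewrite leqNgt; apply/negP => /(linear_dependency (cube_pt R (k:=k)))[c rel [s sS cs0]].
(* Shattering provides a good choice [A] whose signs on [S] are those of [c]; flipping the other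
   points turns the coefficients into [|c s|]. *)
have [|A + AS] := shS [set s in S | 0 <= c s]%SET.
  by apply/subsetP => x; rewrite inE => /andP[].
rewrite inE => /andP[_ /asboolP avY].
suff /(_ s sS)/eqP : {in S, forall s, `|c s| = 0} by rewrite normr_eq0 (negPf cs0).
apply: (@avoids_diagonal_no_relation R k (reorient B A) _ S (fun s => `|c s|)
  (fun s => if 0 <= c s then s else antipode s)) => // [x xS|].
  have xA : (x \in A) = (0 <= c x) by move/setP/(_ x): AS; rewrite !inE xS andbT.
  rewrite !inE; case: ifP => cx; first by rewrite xA cx.
  by rewrite imset_f ?orbT // inE xA cx (subsetP SB).
rewrite -[RHS]rel; apply: eq_bigr => x _; case: ifP => cx; first by rewrite ger0_norm.
by rewrite cube_pt_antipode ltr0_norm ?scalerN ?scaleNr ?opprK // ltNge cx.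
Qed.

(** * Counting the subsets that avoid the diagonal *)

(** A transversal of the antipodal map: the points with first coordinate +1. The dimension is a
    successor so that this coordinate exists. *)
Definition half_Qstar (R : realType) (k : nat) : {set {ffun 'I_k.+1 -> bool}} :=
  [set s in Qstar R k.+1 | ~~ s ord0]%SET.

Lemma card_Qstar (R : realType) (k : nat) :
  #|Qstar R k.+1| = #|half_Qstar R k|.*2.
Proof.
rewrite -(cardsID (half_Qstar R k)) -addnn; congr addn.
  by apply: eq_card => s; rewrite !inE andbA andbb.
rewrite -[RHS](card_imset _ (can_inj (@antipodeK k.+1))); apply: eq_card => s.
rewrite -[in RHS](antipodeK s) (mem_imset _ _ (can_inj (@antipodeK k.+1))).
rewrite !(inE, in_setD) -/(Qstar R k.+1).
have := antipode_Qstar R s; rewrite !inE => ->; rewrite ffunE negbK.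
by case: (_ != - _); case: (_ != _); case: (s ord0).
Qed.

(** Union bound: fold [Y] into the transversal to get [B], then bound the good sign choices on each
    [B]. The last index k + 1 of the sum is the dimension. *)
Lemma card_avoiding_msubsets (R : realType) (k m : nat) :
  (#|[set Y in msubsets R k.+1 m | `[< avoids_diagonal R Y >]]%SET|
     <= 'C(#|half_Qstar R k|, m) * \sum_(i < k.+2) 'C(m, i))%N.
Proof.
pose draws := [set B : {set {ffun 'I_k.+1 -> bool}} |
                 (B \subset half_Qstar R k) && (#|B| == m)]%SET.
pose good (B : {set {ffun 'I_k.+1 -> bool}}) :=
    [set A in powerset B | `[< avoids_diagonal R (reorient B A) >]]%SET.
have cover : [set Y in msubsets R k.+1 m | `[< avoids_diagonal R Y >]]%SET \subset
    (\bigcup_(B in draws) [set reorient B A | A in good B])%SET.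
  apply/subsetP => Y /setIdP[/setIdP[YQ /eqP Ym] /asboolP avY].
  pose A := (Y :&: half_Qstar R k)%SET.
  pose O := [set antipode s | s in Y :\: half_Qstar R k]%SET.
  have inO s : (s \in O) = (antipode s \in (Y :\: half_Qstar R k)%SET).
    by rewrite -{1}(antipodeK s) mem_imset //; exact: can_inj (@antipodeK _).
  have AO s : s \in O -> s \in A = false.
    (* A common point of [O] and [A] would lie in [Y] together with its antipode. This disjointness
       ensures that folding preserves the cardinal m. *)
    rewrite inO inE => /andP[_ asY]; rewrite inE; apply/negbTE; rewrite negb_and.
    by apply/orP; left; rewrite -(antipodeK s) (avoids_diagonal_antipode avY asY).
  have BA : ((A :|: O) :\: A = O)%SET.
    by apply/setP => s; rewrite in_setD in_setU; have := AO s;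
      case: (s \in A); case: (s \in O) => // ->.
  have reY : reorient (A :|: O)%SET A = Y.
    rewrite /reorient BA -imset_comp.
    rewrite (eq_imset (g := id)) ?imset_id ?setID // => s /=; exact: antipodeK.
  apply/bigcupP; exists (A :|: O)%SET.
    rewrite inE; apply/andP; split.
      apply/subsetP => s /setUP[/setIP[]//|]; rewrite inO => /setDP[asY].
      have asQ := subsetP YQ _ asY.
      apply: contraR => ns; apply/setIdP; split=> //; rewrite ffunE negbK.
      by apply: contraR ns => s0; apply/setIdP; split=> //; rewrite -antipode_Qstar.
    rewrite -Ym -(cardsID (half_Qstar R k) Y) cardsU.
    have -> : (A :&: O = finset.set0)%SET.
      by apply/setP => s; rewrite in_setI in_set0; have := AO s;
        case: (s \in O); rewrite ?andbF // => ->.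
    by rewrite cards0 subn0 card_imset //; exact: can_inj (@antipodeK _).
  apply/imsetP; exists A; rewrite ?reY // inE powersetE subsetUl reY; exact/asboolP.
apply: leq_trans (subset_leq_card cover) _.
rewrite -cards_draws -/draws -sum_nat_const.
apply: (@leq_trans (\sum_(B in draws) #|[set reorient B A | A in good B]%SET|)).
  elim/big_rec2: _ => [|B n U _ IH]; first by rewrite cards0.
  by rewrite (leq_trans (leq_card_setU _ _)) // leq_add2l.
apply: leq_sum => B; rewrite inE => /andP[_ /eqP <-].
by rewrite (leq_trans (leq_imset_card _ _)) // card_reorient_avoids.
Qed.

(** * Bounds on the probability and the limit *)

Lemma tau_ge0 (R : realType) (k m : nat) : 0 <= tau R k m.
Proof. by rewrite divr_ge0. Qed.

Lemma tau_le_bin_sum (R : realType) (k m : nat) :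
  tau R k.+1 m * 2 ^+ m <= (\sum_(i < k.+2) 'C(m, i))%N%:R.
Proof.
rewrite /tau; have -> : #|msubsets R k.+1 m| = 'C(#|half_Qstar R k|.*2, m).
  by rewrite -card_Qstar -cards_draws; apply: eq_card => Y; rewrite !inE.
have := card_avoiding_msubsets R k m; have := exp2_bin_le #|half_Qstar R k| m.
set N := #|half_Qstar R k|; set a := #|_|; set b := (\sum_(i < _) _)%N.
(* Without any m-subset, [tau] is 0 by the convention on division. *)
have [->|M0] := posnP 'C(N.*2, m); first by rewrite invr0 mulr0 mul0r.
move=> le2 lea; rewrite mulrAC ler_pdivrMr ?ltr0n // -natrX -!natrM ler_nat.
by rewrite (leq_trans (leq_mul lea (leqnn _))) // mulnC mulnA mulnC leq_mul.
Qed.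

Lemma tau_le (R : realType) (k m : nat) : (k.+1.*2 <= m)%N ->
  tau R k.+1 m * (m%:R - k.+1%:R *+ 2) ^+ 2 <= m%:R.
Proof.
move=> km; have p2 : 0 < 2 ^+ m :> R by rewrite exprn_gt0.
rewrite -(ler_pM2r p2); apply: le_trans (sum_bin_tail_le R km).
by rewrite mulrAC ler_wpM2r ?sqr_ge0 // tau_le_bin_sum.
Qed.

Lemma tau_ceil_le (R : realType) (eps : R) (k : nat) : 0 < eps ->
  tau R k.+1 `|Num.ceil ((2 + eps) * k.+1%:R)|%N
    <= 2 * (2 + eps) / eps ^+ 2 * harmonic k.+1.
Proof.
move=> eps_gt0.
set m := `|_|%N.
have mge : (2 + eps) * k.+1%:R <= m%:R :> R.
  rewrite /m natr_absz ger0_norm ?ceil_ge //.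
  by rewrite -(ler_int R) (le_trans _ (ceil_ge _)) // mulr_ge0 // addr_ge0 // ltW.
have n_ge1 : 1 <= k.+1%:R :> R by rewrite ler1n.
have m_gt0 : 0 < m%:R :> R by apply: lt_le_trans mge; rewrite mulr_gt0 ?ltr0n ?addr_gt0.
have km : (k.+1.*2 <= m)%N by rewrite -(ler_nat R) -muln2 natrM; nra.
have := tau_le R km; have := tau_ge0 R k.+1 m.
set t := tau _ _ _.
set n : R := k.+1%:R in n_ge1 mge *; set M : R := m%:R in m_gt0 mge *.
move=> t_ge0 tM.
(* Both follow from M >= (2 + eps) n. Their product bounds eps^2 n M by (2 + eps) (M - 2n)^2, after
   which M cancels. *)
have d1 : eps * n <= M - n *+ 2 by lra.
have d2 : eps * M <= (2 + eps) * (M - n *+ 2) by nra.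
have tn : t * (eps ^+ 2 * n) <= 2 + eps.
  rewrite -(ler_pM2r m_gt0).
  apply: (@le_trans _ _ ((2 + eps) * (t * (M - n *+ 2) ^+ 2))).
    have -> : t * (eps ^+ 2 * n) * M = t * ((eps * n) * (eps * M)) by ring.
    have -> : (2 + eps) * (t * (M - n *+ 2) ^+ 2) =
      t * ((M - n *+ 2) * ((2 + eps) * (M - n *+ 2))) by ring.
    by rewrite ler_wpM2l // ler_pM // !mulr_ge0 ?ltW //; lra.
  by rewrite ler_wpM2l // addr_ge0 // ltW.
rewrite /harmonic /= ler_pdivlMr // ler_pdivlMr ?exprn_gt0 //.
(* [harmonic k.+1] is 1 / (k + 2), whence the factor 2 in the bound. *)
have : k.+2%:R <= 2 * n by rewrite -natr1 -/n; lra.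
have : 0 <= t * eps ^+ 2 by rewrite mulr_ge0 // sqr_ge0.
nra.
Qed.

Theorem theorem3 (R : realType) (eps : R) (eps_gt0 : 0 < eps) :
  tau R k `|Num.ceil ((2 + eps) * k%:R)|%N @[k --> \oo] --> (0 : R).
Proof.
apply: (@squeeze_cvgr _ _ _ _ (fun=> 0)
  (fun k => 2 * (2 + eps) / eps ^+ 2 * harmonic k)).
- near=> k; rewrite tau_ge0 /=.
  (* The estimate is available in positive dimension only, which holds eventually. *)
  have k_gt0 : (0 < k)%N by near: k; exact: nbhs_infty_gt.
  by rewrite -(prednK k_gt0) tau_ceil_le.
- exact: cvg_cst.
- by rewrite -[X in _ --> X](mulr0 (2 * (2 + eps) / eps ^+ 2));
    apply: cvgMl_tmp; exact: cvg_harmonic.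
Unshelve. all: by end_near.
Qed.
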